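(* Let $\mathcal{C}=\{[X_0,X_1,X_2,X_3]\in\mathbb{CP}^3:\ X_0X_3^2+X_1^2X_2=0\}$. The discriminant locus of the cubic scroll $\mathcal{C}$ is the singular surface $$Disc(\mathcal{C})=\Sigma=\hat{\mathbb{C}}_i\ \cup\bigcup_{\substack{P\in\{0,\infty\}\\ z_m\in\mathbb{C}_i,\ z_m^3=-1}}\Sigma_{P,z_m},$$ where $\Sigma_{P,z_m}$ denotes a handle pinched to $\hat{\mathbb{C}}_i$ at $P$ and $z_m$. In particular, $$G_0=\left\{0,\,-1,\,\tfrac12+i\tfrac{\sqrt3}{2},\,\tfrac12-i\tfrac{\sqrt3}{2},\,\infty\right\}\subset\hat{\mathbb{C}}_i,\qquad G_1=\emptyset,\qquad G_2=\Sigma\setminus G_0 .$$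
   Context: Let $\mathbb{H}$ be the quaternions with basis $1,i,j,k$, and $\mathbb{C}_i=\mathbb{R}+\mathbb{R}i$, identified with $\mathbb{C}$. The left quaternionic projective line $\mathbb{HP}^1$ is the set of classes $[q_1,q_2]\sim[pq_1,pq_2]$, $p\in\mathbb{H}\setminus\{0\}$. One identifies $\mathbb{S}^4\simeq\mathbb{HP}^1=\mathbb{H}\cup\{\infty\}$ via $q\mapsto[1,q]$, $\infty=[0,1]$, and writes $\hat{\mathbb{C}}_i=\mathbb{C}_i\cup\{\infty\}\subset\mathbb{S}^4$. The twistor fibration is $\pi:\mathbb{CP}^3\to\mathbb{HP}^1$, $\pi[X_0,X_1,X_2,X_3]=[X_0+X_1j,\,X_2+X_3j]$. For the surface $\mathcal{C}$ of degree $3$, $Disc(\mathcal{C})=\{q\in\mathbb{S}^4:\ \#(\pi^{-1}(q)\cap\mathcal{C})\neq 3\}$; $G_0$ is the set of $q\in\mathbb{S}^4$ with $\pi^{-1}(q)\subset\mathcal{C}$, and for $n=1,2$, $G_n=\{q\in\mathbb{S}^4:\ \#(\pi^{-1}(q)\cap\mathcal{C})=n\}$, so that $Disc(\mathcal{C})=G_0\cup G_1\cup G_2$. A handle $\Sigma_{P,z}$ pinched to $\hat{\mathbb{C}}_i$ at $P$ and $z$ is a surface in $\mathbb{S}^4$ containing $P$ and $z$, meeting $\hat{\mathbb{C}}_i$ exactly in $\{P,z\}$, and such that $\Sigma_{P,z}\setminus\{P,z\}$ is homeomorphic to a cylinder $\mathbb{S}^1\times(0,1)$ whose two ends are collapsed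 to $P$ and $z$ respectively; distinct handles meet at most at their common attaching points. *)

(* Defs.v *)
From HB Require Import structures.
From mathcomp Require Import all_boot all_order all_algebra.
From mathcomp Require Import generic_quotient complex ring lra.
From mathcomp Require Import all_classical all_reals all_analysis.

Set Implicit Arguments.
Unset Strict Implicit.
Unset Printing Implicit Defensive.

Import Order.TTheory GRing.Theory Num.Theory.
Import numFieldNormedType.Exports.

Local Open Scope classical_set_scope.
Local Open Scope ring_scope.
Local Open Scope card_scope.
Local Open Scope quotient_scope.
Local Open Scope complex_scope.

(* (a, b, c, d) stands for a + b i + c j + d k.  The type is an alias of
   the product, from which it takes the additive group and the topology, so
   that its ring structure is the Hamilton product and not the
   componentwise one. *)
Definition quat (R : realType) : Type := (R * R * R * R)%type.

HB.instance Definition _ (R : realType) := Choice.on (quat R).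
HB.instance Definition _ (R : realType) := GRing.Zmodule.on (quat R).
HB.instance Definition _ (R : realType) := PseudoMetric.on (quat R).

Definition mulq (R : realType) (p q : quat R) : quat R :=
  let: (a, b, c, d) := p in let: (a', b', c', d') := q in
  (a * a' - b * b' - c * c' - d * d',
   a * b' + b * a' + c * d' - d * c',
   a * c' - b * d' + c * a' + d * b',
   a * d' + b * c' - c * b' + d * a').

Section QuatRing.
Variable R : realType.
Implicit Types p q r : quat R.

Let oneq : quat R := (1, 0, 0, 0).

Let pair4 (a b c d a' b' c' d' : R) :
  a = a' -> b = b' -> c = c' -> d = d' -> (a, b, c, d) = (a', b', c', d').
Proof. by move=> -> -> -> ->. Qed.

Lemma mulqA : associative (@mulq R).
Proof.
by move=> [[[? ?] ?] ?] [[[? ?] ?] ?] [[[? ?] ?] ?]; apply: pair4; ring.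
Qed.

Lemma mul1q : left_id oneq (@mulq R).
Proof. by move=> [[[? ?] ?] ?]; apply: pair4; ring. Qed.

Lemma mulq1 : right_id oneq (@mulq R).
Proof. by move=> [[[? ?] ?] ?]; apply: pair4; ring. Qed.

Lemma mulqDl : left_distributive (@mulq R) +%R.
Proof.
by move=> [[[? ?] ?] ?] [[[? ?] ?] ?] [[[? ?] ?] ?]; apply: pair4 => /=; ring.
Qed.

Lemma mulqDr : right_distributive (@mulq R) +%R.
Proof.
by move=> [[[? ?] ?] ?] [[[? ?] ?] ?] [[[? ?] ?] ?]; apply: pair4 => /=; ring.
Qed.

Lemma oneq_neq0 : oneq != 0.
Proof. by apply/eqP => -[] /eqP; rewrite oner_eq0. Qed.

HB.instance Definition _ := GRing.Zmodule_isNzRing.Build (quat R)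
  mulqA mul1q mulq1 mulqDl mulqDr oneq_neq0.

Lemma quatME p q : p * q = mulq p q.
Proof. by []. Qed.

Lemma quat_inv q : q != 0 -> exists2 p : quat R, p != 0 & p * q = 1.
Proof.
move: q => [[[a b] c] d] q0; pose n := a ^+ 2 + b ^+ 2 + c ^+ 2 + d ^+ 2.
have n0 : n != 0.
  apply: contra q0 => /eqP n0.
  have [a0 b0 c0 d0] : [/\ a ^+ 2 = 0, b ^+ 2 = 0, c ^+ 2 = 0 & d ^+ 2 = 0].
    have := sqr_ge0 a; have := sqr_ge0 b; have := sqr_ge0 c.
    by have := sqr_ge0 d; move: n0; rewrite /n => *; split; lra.
  move: a0 b0 c0 d0 => /eqP + /eqP + /eqP + /eqP.
  by rewrite !sqrf_eq0 => /eqP-> /eqP-> /eqP-> /eqP->.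
pose p : quat R := (a / n, - b / n, - c / n, - d / n).
have pq : p * (a, b, c, d) = 1 by apply: pair4; rewrite /n; field.
by exists p => //; apply: contraPneq pq => ->; rewrite mul0r => /esym/eqP;
  rewrite oner_eq0.
Qed.

End QuatRing.

Section TwistorFibration.
Variable R : realType.
Local Notation H := (quat R).
Local Notation C := R[i].

Definition quatj : H := (0, 0, 1, 0).

(* the inclusion of C_i = R + R i *)
Definition quatC (z : C) : H := let: a +i* b := z in (a, b, 0, 0).

Lemma quatCM (z w : C) : quatC (z * w) = quatC z * quatC w.
Proof.
by case: z w => [a b] [c d]; congr (_, _, _, _); rewrite /=; ring.
Qed.

Definition HP1_pre := {q : H * H | q != 0}.

Definition HP1_rel (u v : HP1_pre) : bool :=
  `[< exists2 p : H, p != 0 & val v = (p * (val u).1, p * (val u).2) >].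

Lemma HP1_rel_refl : reflexive HP1_rel.
Proof.
move=> u; apply/asboolP; exists 1; first exact: oner_neq0.
by rewrite !mul1r -surjective_pairing.
Qed.

Lemma HP1_rel_sym : symmetric HP1_rel.
Proof.
suff sub u v : HP1_rel u v -> HP1_rel v u by move=> u v; apply/idP/idP => /sub.
move=> /asboolP[p p0 vE]; apply/asboolP; have [p' p'0 pp'] := quat_inv p0.
by exists p' => //; rewrite vE /= !mulrA pp' !mul1r -surjective_pairing.
Qed.

Lemma HP1_rel_trans : transitive HP1_rel.
Proof.
move=> v u w /asboolP[p p0 vE] /asboolP[q q0 wE]; apply/asboolP.
exists (q * p); last by rewrite wE vE /= !mulrA.
have [q' _ q'q] := quat_inv q0.
by apply: contra_neq p0 => qp0; rewrite -[p]mul1r -q'q -mulrA qp0 mulr0.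
Qed.

Canonical HP1_equiv := EquivRel HP1_rel HP1_rel_refl HP1_rel_sym HP1_rel_trans.

Definition HP1 := {eq_quot HP1_equiv}.

Definition CP3_pre := {X : 'rV[C]_4 | X != 0}.

Definition CP3_rel (u v : CP3_pre) : bool :=
  `[< exists2 l : C, l != 0 & val v = l *: val u >].

Lemma CP3_rel_refl : reflexive CP3_rel.
Proof.
by move=> u; apply/asboolP; exists 1; rewrite ?scale1r ?oner_neq0.
Qed.

Lemma CP3_rel_sym : symmetric CP3_rel.
Proof.
suff sub u v : CP3_rel u v -> CP3_rel v u by move=> u v; apply/idP/idP => /sub.
move=> /asboolP[l l0 vE]; apply/asboolP; exists l^-1; rewrite ?invr_neq0 //.
by rewrite vE scalerA mulVf // scale1r.
Qed.

Lemma CP3_rel_trans : transitive CP3_rel.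
Proof.
move=> v u w /asboolP[l l0 vE] /asboolP[m m0 wE]; apply/asboolP.
by exists (m * l); rewrite ?mulf_neq0 // wE vE scalerA.
Qed.

Canonical CP3_equiv := EquivRel CP3_rel CP3_rel_refl CP3_rel_sym CP3_rel_trans.

Definition CP3 := {eq_quot CP3_equiv}.

Definition twistor_coord (X : 'rV[C]_4) : H * H :=
  (quatC (X 0 0) + quatC (X 0 1) * quatj,
   quatC (X 0 2) + quatC (X 0 3) * quatj).

Lemma quatCDj_eq0 (z w : C) : quatC z + quatC w * quatj = 0 -> z = 0 /\ w = 0.
Proof.
case: z w => [a b] [c d] []; rewrite /= !(mulr0, mul0r, mulr1).
by rewrite !(subr0, addr0, add0r) => -> -> -> ->.
Qed.

Lemma twistor_coord_neq0 (X : 'rV[C]_4) : X != 0 -> twistor_coord X != 0.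
Proof.
apply: contra => /eqP X_0.
have [X0 X1] := quatCDj_eq0 (congr1 fst X_0).
have [X2 X3] := quatCDj_eq0 (congr1 snd X_0).
apply/eqP/rowP => -[[|[|[|[|//]]]] lti]; rewrite mxE.
- by rewrite -[RHS]X0; congr (X _ _); apply: val_inj.
- by rewrite -[RHS]X1; congr (X _ _); apply: val_inj.
- by rewrite -[RHS]X2; congr (X _ _); apply: val_inj.
- by rewrite -[RHS]X3; congr (X _ _); apply: val_inj.
Qed.

Definition twistor_pre (X : CP3_pre) : HP1_pre :=
  exist _ (twistor_coord (val X)) (twistor_coord_neq0 (valP X)).

Definition twistor (x : CP3) : HP1 := \pi_HP1 (twistor_pre (repr x)).

Lemma twistorE (X : CP3_pre) : twistor (\pi_CP3 X) = \pi_HP1 (twistor_pre X).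
Proof.
have /eqmodP/asboolP[l l0 XE] : repr (\pi_CP3 X) = X %[mod CP3].
  by rewrite reprK.
apply/eqmodP/asboolP; exists (quatC l).
  by apply: contra l0; case: (l) => a b /eqP[-> ->].
by rewrite /= XE /twistor_coord !mxE !quatCM !mulrDr !mulrA.
Qed.

(* S^4 = H u {oo}, with [None] the point at infinity *)
Definition S4 : Type := one_point_compactification H.
HB.instance Definition _ := Topological.on S4.

Lemma chart_neq0 (q : H) : ((1, q) : H * H) != 0.
Proof. by apply/eqP => -[] /eqP; rewrite oner_eq0. Qed.

Lemma infty_neq0 : ((0, 1) : H * H) != 0.
Proof. by apply/eqP => -[] /eqP; rewrite oner_eq0. Qed.

Definition S4_HP1 (q : S4) : HP1 :=
  if q is Some q' then \pi_HP1 (exist _ (1, q') (chart_neq0 q'))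
  else \pi_HP1 (exist _ (0, 1) infty_neq0).

Definition fibre (q : S4) : set CP3 := twistor @^-1` [set S4_HP1 q].

Definition discriminant_locus (d : nat) (S : set CP3) : set S4 :=
  [set q | ~ (fibre q `&` S #= `I_d)].

Definition G0 (S : set CP3) : set S4 := [set q | fibre q `<=` S].

(* the G_n of the text, for n > 0 *)
Definition Gpos (n : nat) (S : set CP3) : set S4 :=
  [set q | fibre q `&` S #= `I_n].

Definition cubic_scroll : set CP3 :=
  [set x | exists2 X : CP3_pre, x = \pi_CP3 X &
    let X_ k := val X 0 k in X_ 0 * X_ 3 ^+ 2 + X_ 1 ^+ 2 * X_ 2 = 0].

Definition S4C (z : C) : S4 := Some (quatC z).
Definition S4oo : S4 := None.

Definition hatC : set S4 := range S4C `|` [set S4oo].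

(* S^1 x (0,1), with S^1 the unit circle of R^2 *)
Definition cylinder : set (R * R * R) :=
  [set x | x.1.1 ^+ 2 + x.1.2 ^+ 2 = 1 /\ 0 < x.2 < 1].

(* h, with inverse g, is the homeomorphism of the cylinder with S \ {P, z};
   its end at 0 is collapsed to P and its end at 1 to z, both uniformly in
   the circle coordinate. *)
Definition pinched_handle (P z : S4) (S : set S4) : Prop :=
  [/\ S P, S z, S `&` hatC = [set P; z] &
   exists (h : R * R * R -> S4) (g : S4 -> R * R * R),
   [/\ {within cylinder, continuous h},
       {within S `\` [set P; z], continuous g},
       h @` cylinder = S `\` [set P; z],
       (forall x, cylinder x -> g (h x) = x) &
       (forall U, nbhs P U ->
          \forall t \near 0^'+, forall u, cylinder (u, t) -> U (h (u, t))) /\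
       (forall U, nbhs z U ->
          \forall t \near 1^'-, forall u, cylinder (u, t) -> U (h (u, t)))]].

Definition handle_ends : set S4 := [set S4C 0; S4oo].
Definition handle_roots : set C := [set z | z ^+ 3 = -1].

End TwistorFibration.

Arguments quatj {R}.
Arguments S4oo {R}.
Arguments hatC : clear implicits.
Arguments handle_ends : clear implicits.
Arguments handle_roots : clear implicits.
Arguments cubic_scroll : clear implicits.

(* Main.v *)
Require Import Defs.
From mathcomp Require Import all_boot all_order all_algebra.
From mathcomp Require Import generic_quotient complex ring lra.
From mathcomp Require Import all_classical all_reals all_analysis.

Import Order.TTheory GRing.Theory Num.Theory.
Import numFieldNormedType.Exports.

Local Open Scope classical_set_scope.
Local Open Scope ring_scope.
Local Open Scope card_scope.
Local Open Scope quotient_scope.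
Local Open Scope complex_scope.

(** Write a point of H as q = a + b j with a, b in C_i.  The fibre over q is
    the line of the points [X0, X1, X0 a - X1 b', X0 b + X1 a'], where x' is
    the conjugate of x, and on it the equation of the surface becomes the
    binary cubic
      b^2 X0^3 + 2 b a' X0^2 X1 + (a'^2 + a) X0 X1^2 - b' X1^3.

    For b = 0, that is on the sphere C_i u {oo}, it is (a'^2 + a) X0 X1^2: two
    points, unless a'^2 + a = 0, when the whole line lies on the surface.  The
    solutions of a'^2 + a = 0 are 0 and the cube roots of -1; at infinity the
    whole line lies on the surface as well.

    For b != 0 the affine coordinate y = b X0 / X1 turns the cubic into
      y^3 + 2 a' y^2 + (a'^2 + a) y - s,   s = |b|^2 > 0  (fibre_cubic_roots),
    which depends on b only through s and never has a triple root
    (no_triple_root).  So such a q lies on the discriminant locus iff the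
    discriminant of this cubic vanishes, and then its fibre has two points.

    The vanishing of this complex number is two real equations.  The imaginary
    part is a product, so that either a^3 is real or s = 1 - |a|^2, and in the
    second case the real part says (1 - r) (3 + r)^3 <= 0 for r = |a| < 1
    (fibre_disc0_real), which is absurd.  The sign of the real part then leaves
    only a = t z with t > 0 and z^3 = -1 (fibre_disc0_ray), and there the
    discriminant is a quadratic in s with at most one positive root, which
    exists iff t != 1.  The curve of pairs (t, s) is rational:
      t = 3 p^2 / (1 + 2 p),   s = 2 p^3 (1 - p)^2 / (1 + 2 p)^2,   p > 0.
    Each p != 1 contributes a circle |b|^2 = s, which shrinks to a point as p
    tends to 0 (at q = 0) and to 1 (at q = z), while q tends to oo with p.
    The intervals 0 < p < 1 and 1 < p therefore give, over each z, one handle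
    pinched at 0 and z and one pinched at oo and z. *)

(** * Monic cubics over an algebraically closed field *)

Lemma card_set2 {T : Type} (x y : T) : x <> y -> [set x; y] #= `I_2.
Proof.
move=> xy; apply/eq_cardSP; exists y; first by right.
suff -> : [set x; y] `\ y = [set x] by exact: card_set1.
by apply/seteqP; split=> z /=; [case=> -[]|move=> ->; split; [left|]].
Qed.

Lemma card_set3 {T : Type} (x y z : T) :
  x <> y -> x <> z -> y <> z -> [set x; y; z] #= `I_3.
Proof.
move=> xy xz yz; apply/eq_cardSP; exists z; first by right.
suff -> : [set x; y; z] `\ z = [set x; y] by exact: card_set2.
apply/seteqP; split=> t /=; first by case=> -[].
by case=> ->; split=> //; left; [left|right].
Qed.

Definition cubic_disc {F : nzRingType} (p q r : F) : F :=
  p ^+ 2 * q ^+ 2 - 4 * q ^+ 3 - 4 * p ^+ 3 * r + 18 * p * q * r - 27 * r ^+ 2.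

Definition cubic_roots {F : nzRingType} (p q r : F) : set F :=
  [set y | y ^+ 3 + p * y ^+ 2 + q * y + r = 0].

Lemma monic_cubic_split {F : closedFieldType} (p q r : F) :
  exists y1 y2 y3 : F, [/\ p = - (y1 + y2 + y3),
    q = y1 * y2 + y1 * y3 + y2 * y3 & r = - (y1 * y2 * y3)].
Proof.
pose f : {poly F} := 'X^3 + p *: 'X^2 + q *: 'X + r%:P.
have f3 : f`_3 = 1 by rewrite !coefE /= !mulr0 !addr0.
have szf : size f = 4%N.
  apply/eqP; rewrite eqn_leq; apply/andP; split.
    by apply/leq_sizeP => -[|[|[|[|j]]]] // _; rewrite !coefE /= !mulr0 !addr0.
  by rewrite ltnNge; apply/negP => /leq_sizeP/(_ 3%N isT)/eqP;
    rewrite f3 oner_eq0.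
have [s fE] := closed_field_poly_normal f.
have lf : lead_coef f = 1 by rewrite /lead_coef szf f3.
have sz : size s = 3%N.
  by apply/eqP; rewrite -eqSS -szf fE lf scale1r size_prod_XsubC.
move: s sz fE => [|y1 [|y2 [|y3 [|//]]]] // _.
rewrite lf scale1r !big_cons big_nil mulr1 => fE.
exists y1, y2, y3.
have fE' : f = 'X^3 - (y1 + y2 + y3) *: 'X^2
    + (y1 * y2 + y1 * y3 + y2 * y3) *: 'X - (y1 * y2 * y3)%:P.
  rewrite fE -!mul_polyC !(polyCD, polyCM); ring.
split.
- by have := congr1 (fun g : {poly F} => g`_2) fE';
    rewrite !coefE /= !(mulr0, mulr1, addr0, add0r, subr0).
- by have := congr1 (fun g : {poly F} => g`_1) fE';
    rewrite !coefE /= !(mulr0, mulr1, addr0, add0r, subr0, oppr0).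
- by have := congr1 (fun g : {poly F} => g`_0) fE';
    rewrite !coefE /= !(mulr0, mulr1, addr0, add0r, subr0, oppr0).
Qed.

(** The discriminant is the square of the product of the differences of the
    roots, so that it vanishes iff two of them coincide; without a triple root
    exactly two remain. *)
Lemma card_cubic_roots {F : closedFieldType} (p q r : F) :
  ~ (exists y, [/\ p = - (3 * y), q = 3 * y ^+ 2 & r = - y ^+ 3]) ->
  if cubic_disc p q r == 0 then cubic_roots p q r #= `I_2
  else cubic_roots p q r #= `I_3.
Proof.
have [y1 [y2 [y3 [-> -> ->]]]] := monic_cubic_split p q r.
set p' := - (y1 + y2 + y3); set r' := - (y1 * y2 * y3).
set q' := y1 * y2 + _ + _.
move=> not_triple.
have -> : cubic_roots p' q' r' = [set y1; y2; y3].
  apply/seteqP; split=> y; rewrite /cubic_roots /=.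
    have -> : y ^+ 3 + p' * y ^+ 2 + q' * y + r' = (y - y1) * (y - y2) * (y - y3).
      by rewrite /p' /q' /r'; ring.
    move=> /eqP; rewrite !mulf_eq0 !subr_eq0.
    by move=> /orP[/orP[]|] /eqP; [left; left|left; right|right].
  by rewrite /p' /q' /r'; case=> [[]|] ->; ring.
have -> : cubic_disc p' q' r' = ((y1 - y2) * (y1 - y3) * (y2 - y3)) ^+ 2.
  by rewrite /cubic_disc /p' /q' /r'; ring.
rewrite sqrf_eq0 !mulf_eq0 !subr_eq0.
have [y12|y12] /= := eqVneq y1 y2.
  have y13 : y1 <> y3.
    by move=> y13; apply: not_triple; exists y1; rewrite /p' /q' /r' -y12 -y13;
       split; ring.
  by rewrite -y12 setUid; exact: card_set2.
have [y13|y13] /= := eqVneq y1 y3.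
  by rewrite -y13 setUAC setUid; apply: card_set2; apply/eqP.
have [y23|y23] := eqVneq y2 y3.
  by rewrite -y23 -setUA setUid; apply: card_set2; apply/eqP.
by apply: card_set3; apply/eqP.
Qed.

(** * The discriminant over a point a + b j *)

Section CubicScroll.
Variable R : realType.
Local Notation C := R[i].
Implicit Types (P q : S4 R) (a b z : C) (p s t : R).

(** Up to sign, the discriminant of the cubic in y whose roots are the points
    of the surface over a + b j, with s = |b|^2. *)
Definition fibre_disc a s : R[i] :=
  27 * s%:C ^+ 2 + 4 * s%:C * (a^* ^+ 3 + 9 * (a * a^*))
  + 4 * a * (a^* ^+ 2 + a) ^+ 2.

Lemma fibre_discE a s : cubic_disc (2 * a^*) (a^* ^+ 2 + a) (- s%:C) = - fibre_disc a s.
Proof. rewrite /cubic_disc /fibre_disc; ring. Qed.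

(** Here u + i v = a^3 and n = |a|^2.  The point is that the imaginary part is
    a product. *)
Lemma fibre_disc_complex (x y s : R) :
  let u := x ^+ 3 - 3 * x * y ^+ 2 in
  let v := 3 * x ^+ 2 * y - y ^+ 3 in
  let n := x ^+ 2 + y ^+ 2 in
  fibre_disc (x +i* y) s =
  (27 * s ^+ 2 + 4 * s * (u + 9 * n) + 4 * (n * u + 2 * n ^+ 2 + u)) +i*
  (4 * v * (1 - n - s)).
Proof.
rewrite /fibre_disc /=.
(* with real numerals both components are computed by simplification *)
have nat_complex k : k%:R = k%:R%:C :> R[i] by rewrite rmorph_nat.
rewrite !nat_complex !exprS !expr0 !mulr1.
apply/eqP; rewrite eq_complex /=; apply/andP; split; apply/eqP; ring.
Qed.

Lemma cube_complex (x y : R) : (x +i* y) ^+ 3 =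
  (x ^+ 3 - 3 * x * y ^+ 2) +i* (3 * x ^+ 2 * y - y ^+ 3).
Proof.
by rewrite !exprS !expr0 !mulr1; apply/eqP; rewrite eq_complex /=;
  apply/andP; split; apply/eqP; ring.
Qed.

Lemma norm_root z : z ^+ 3 = -1 -> complex.Re z ^+ 2 + complex.Im z ^+ 2 = 1.
Proof.
case: z => x y; rewrite cube_complex => -[z3r z3i] /=.
have /eqP : (x ^+ 2 + y ^+ 2) ^+ 3 = 1.
  have -> : (x ^+ 2 + y ^+ 2) ^+ 3 =
    (x ^+ 3 - 3 * x * y ^+ 2) ^+ 2 + (3 * x ^+ 2 * y - y ^+ 3) ^+ 2 by ring.
  by rewrite z3r z3i; ring.
by rewrite pexpr_eq1 //; [move/eqP|by rewrite addr_ge0 ?sqr_ge0].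
Qed.

(** On the ray a = t z with z^3 = -1, let y = w / z be the double root.  Then
    the derivative of the cubic vanishes iff (w + t) (3 w + t) = t, and
    p = w + t gives t = 3 p^2 / (1 + 2 p) and s = 2 w^2 p.  Here [ray p] is t
    and [height2 p] is s. *)
Definition ray p : R := 3 * p ^+ 2 / (1 + 2 * p).
Definition height2 p : R := 2 * p ^+ 3 * (1 - p) ^+ 2 / (1 + 2 * p) ^+ 2.
(** The positive root p of 3 p^2 - 2 t p - t = 0. *)
Definition ray_inv t : R := (t + Num.sqrt (t ^+ 2 + 3 * t)) / 3.

Lemma ray_gt0 p : 0 < p -> 0 < ray p.
Proof. by move=> p0; rewrite /ray divr_gt0 ?mulr_gt0 ?exprn_gt0 //; lra. Qed.

Lemma ray_inv_gt0 t : 0 < t -> 0 < ray_inv t.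
Proof.
by move=> t0; rewrite /ray_inv divr_gt0 ?ltr_wpDr ?sqrtr_ge0.
Qed.

Lemma ray_invK t : 0 < t -> ray (ray_inv t) = t.
Proof.
move=> t0; have p0 := ray_inv_gt0 t t0.
have : (3 * ray_inv t - t) ^+ 2 = t ^+ 2 + 3 * t.
  have -> : 3 * ray_inv t - t = Num.sqrt (t ^+ 2 + 3 * t).
    by rewrite /ray_inv; field.
  by rewrite sqr_sqrtr //; nra.
move: (ray_inv t) p0 => p p0 pE.
have eq : 3 * p ^+ 2 = t * (1 + 2 * p) by nra.
by rewrite /ray eq mulfK //; lra.
Qed.

Lemma rayK p : 0 < p -> ray_inv (ray p) = p.
Proof.
move=> p0; have t0 := ray_gt0 p p0.
have d0 : 1 + 2 * p != 0 by lra.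
rewrite /ray_inv.
have -> : ray p ^+ 2 + 3 * ray p = (3 * p - ray p) ^+ 2.
  by rewrite /ray; field.
rewrite sqrtr_sqr ger0_norm; first by field.
have -> : 3 * p - ray p = 3 * p * (1 + p) / (1 + 2 * p) by rewrite /ray; field.
by rewrite divr_ge0 ?mulr_ge0 //; lra.
Qed.

Lemma height2_gt0 p : 0 < p -> p != 1 -> 0 < height2 p.
Proof.
move=> p0 p1; have q0 : 0 < (1 - p) ^+ 2.
  by rewrite exprn_even_gt0 //= subr_eq0 eq_sym.
have p3 : 0 < p ^+ 3 by exact: exprn_gt0.
by rewrite /height2 divr_gt0 ?exprn_gt0 ?(mulr_gt0 (mulr_gt0 _ _)) //; lra.
Qed.

(** The quadratic in s has the roots [height2 p] >= 0 and - s' < 0. *)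
Lemma height2_eq p s : 0 < p -> 0 < s ->
  27 * s ^+ 2 + 4 * s * ray p ^+ 2 * (9 - ray p)
    - 4 * ray p ^+ 3 * (ray p - 1) ^+ 2 = 0 <-> s = height2 p.
Proof.
move=> p0 s0; have d0 : 1 + 2 * p != 0 by lra.
pose s' : R := 2 * p ^+ 3 * (3 * p + 1) ^+ 2 / (1 + 2 * p) ^+ 3.
have -> : 27 * s ^+ 2 + 4 * s * ray p ^+ 2 * (9 - ray p)
    - 4 * ray p ^+ 3 * (ray p - 1) ^+ 2 = 27 * (s - height2 p) * (s + s').
  by rewrite /ray /height2 /s'; field.
have s'0 : 0 < s'.
  by rewrite /s' divr_gt0 ?mulr_gt0 ?exprn_gt0 //; lra.
split=> [/eqP|->]; last by rewrite subrr mulr0 mul0r.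
rewrite !mulf_eq0 subr_eq0 => /orP[/orP[|/eqP //]|]; lra.
Qed.

Lemma fibre_disc_ray p (z : R[i]) s : 0 < p -> 0 < s -> z ^+ 3 = -1 ->
  fibre_disc ((ray p)%:C * z) s = 0 <-> s = height2 p.
Proof.
case: z => x y p0 s0 z3; have /= n1 := norm_root _ z3.
move: z3; rewrite cube_complex => -[z3r z3i].
have -> : (ray p)%:C * (x +i* y) = (ray p * x) +i* (ray p * y).
  by apply/eqP; rewrite eq_complex /= !mul0r subr0 addr0 !eqxx.
rewrite fibre_disc_complex.
have -> : (ray p * x) ^+ 3 - 3 * (ray p * x) * (ray p * y) ^+ 2 = - ray p ^+ 3.
  by rewrite -[RHS]mulrN1 -z3r; ring.
have -> : 3 * (ray p * x) ^+ 2 * (ray p * y) - (ray p * y) ^+ 3 = 0.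
  transitivity (ray p ^+ 3 * (3 * x ^+ 2 * y - y ^+ 3)); first by ring.
  by rewrite z3i oppr0 mulr0.
have -> : (ray p * x) ^+ 2 + (ray p * y) ^+ 2 = ray p ^+ 2.
  by rewrite -[RHS]mulr1 -n1; ring.
rewrite -height2_eq // mulr0 mul0r.
set e := (X in X +i* _); set e' := (X in _ <-> X = _).
have -> : e = e' by rewrite /e /e'; ring.
by split=> [[]|->].
Qed.

(** If Im a^3 != 0, then s = 1 - n for n = |a|^2, so r = |a| < 1.  The real
    part becomes 27 - 18 n - n^2 + 8 u = 0 with u = Re a^3 >= - r^3, while
    27 - 18 r^2 - r^4 - 8 r^3 = (1 - r) (3 + r)^3 > 0. *)
Lemma fibre_disc0_real x y s : 0 < s -> fibre_disc (x +i* y) s = 0 ->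
  3 * x ^+ 2 * y - y ^+ 3 = 0.
Proof.
move=> s0; rewrite fibre_disc_complex.
set u := x ^+ 3 - _; set v := 3 * x ^+ 2 * y - _; set n := x ^+ 2 + _.
move=> -[re /eqP]; rewrite !mulf_eq0 => /orP[/orP[|/eqP //]|/eqP s1]; first lra.
have {}s1 : s = 1 - n by lra.
have un : u ^+ 2 + v ^+ 2 = n ^+ 3 by rewrite /u /v /n; ring.
have n0 : 0 <= n by rewrite addr_ge0 ?sqr_ge0.
pose r := Num.sqrt n; have r0 : 0 <= r by exact: sqrtr_ge0.
have nr : n = r ^+ 2 by rewrite sqr_sqrtr.
have ur : - r ^+ 3 <= u.
  have r3 : 0 <= r ^+ 3 by exact: exprn_ge0.
  have u2 : u ^+ 2 <= (r ^+ 3) ^+ 2.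
    by rewrite -exprM mulnC exprM -nr -un lerDl sqr_ge0.
  rewrite leNgt; apply/negP => ur.
  have : 0 < (u - r ^+ 3) * (u + r ^+ 3) by rewrite nmulr_rgt0; lra.
  by rewrite -subr_sqr; lra.
have r1 : r < 1.
  by rewrite ltNge; apply/negP => /(exprn_ege1 2); rewrite -nr; lra.
have : 0 < (1 - r) * (3 + r) ^+ 3 by rewrite mulr_gt0 ?exprn_gt0 //; lra.
have : 27 - 18 * n - n ^+ 2 + 8 * u = 0 by rewrite -re s1; ring.
rewrite nr => e0 e1.
have : (1 - r) * (3 + r) ^+ 3 = 27 - 18 * r ^+ 2 - (r ^+ 2) ^+ 2 - 8 * r ^+ 3 by ring.
lra.
Qed.

(** Now a^3 = r^3 or a^3 = - r^3 with r = |a|.  In the first case all the terms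
    of the discriminant are nonnegative and 27 s^2 > 0; in the second a / r is
    a cube root of -1. *)
Lemma fibre_disc0_ray a s : 0 < s -> fibre_disc a s = 0 ->
  exists p (z : R[i]), [/\ 0 < p, p != 1, z ^+ 3 = -1, a = (ray p)%:C * z
     & s = height2 p].
Proof.
case: a => x y s0 D0; have v0 := fibre_disc0_real _ _ _ s0 D0.
move: (D0); rewrite fibre_disc_complex v0.
set u := x ^+ 3 - _; set n := x ^+ 2 + _.
move=> -[re _].
have un : u ^+ 2 = n ^+ 3.
  by rewrite -[LHS]addr0 -[X in _ + X](expr0n _ 2) /= -v0 /u /n; ring.
have n0 : 0 <= n by rewrite addr_ge0 ?sqr_ge0.
pose r := Num.sqrt n; have r0 : 0 <= r by exact: sqrtr_ge0.
have nr : n = r ^+ 2 by rewrite sqr_sqrtr.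
have r3 : 0 <= r ^+ 3 by exact: exprn_ge0.
have s2 : 0 < s ^+ 2 by exact: exprn_gt0.
have ur : u = - r ^+ 3.
  have : u ^+ 2 == (r ^+ 3) ^+ 2 by rewrite un nr -!exprM.
  rewrite eqf_sqr => /orP[/eqP ur|/eqP //]; exfalso.
  have u0 : 0 <= u by rewrite ur.
  have : 0 <= s * (u + 9 * n) by rewrite mulr_ge0 //; lra.
  have : 0 <= n * u by rewrite mulr_ge0.
  have : 0 <= n ^+ 2 by rewrite exprn_ge0.
  lra.
have {}r0 : 0 < r.
  rewrite lt_def r0 andbT; apply/negP => /eqP r00.
  by move: re; rewrite ur nr r00; lra.
have r_neq0 : r != 0 by lra.
pose p := ray_inv r; have rp : ray p = r by rewrite ray_invK.
have p0 : 0 < p by rewrite ray_inv_gt0.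
pose z := (x / r) +i* (y / r).
have aE : (x +i* y) = (ray p)%:C * z.
  by apply/eqP; rewrite rp eq_complex /= !mul0r subr0 addr0 ![r * _]mulrC !divfK ?eqxx.
have z3 : z ^+ 3 = -1.
  rewrite cube_complex; apply/eqP; rewrite eq_complex /=; apply/andP; split; apply/eqP.
    transitivity (u / r ^+ 3); first by rewrite /u; field.
    by rewrite ur; field.
  transitivity ((3 * x ^+ 2 * y - y ^+ 3) / r ^+ 3); first by field.
  by rewrite v0 mul0r oppr0.
move: D0; rewrite aE => /(fibre_disc_ray _ _ _ p0 s0 z3) sE.
exists p, z; split=> //; apply/eqP => p1; move: s0.
by rewrite sE p1 /height2 subrr expr0n /= mulr0 mul0r ltxx.
Qed.

(** * The fibres of the twistor fibration *)

Definition row4 (X0 X1 X2 X3 : C) : 'rV[C]_4 :=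
  \row_k [:: X0; X1; X2; X3]`_k.

Lemma row4E (X : 'rV[C]_4) : X = row4 (X 0 0) (X 0 1) (X 0 2) (X 0 3).
Proof.
by apply/rowP => -[[|[|[|[|//]]]] lti]; rewrite mxE /=;
  congr (X _ _); apply: val_inj.
Qed.

Lemma row4_eq0 X0 X1 X2 X3 :
  (row4 X0 X1 X2 X3 == 0) = [&& X0 == 0, X1 == 0, X2 == 0 & X3 == 0].
Proof.
apply/eqP/and4P => [/rowP X0E|[/eqP-> /eqP-> /eqP-> /eqP->]].
  by split; apply/eqP; [have := X0E 0|have := X0E 1|have := X0E 2|have := X0E 3];
     rewrite !mxE.
by apply/rowP => -[[|[|[|[|//]]]] lti]; rewrite !mxE.
Qed.

Lemma row4Z l X0 X1 X2 X3 :
  l *: row4 X0 X1 X2 X3 = row4 (l * X0) (l * X1) (l * X2) (l * X3).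
Proof. by apply/rowP => -[[|[|[|[|//]]]] lti]; rewrite !mxE. Qed.

Lemma row4_inj X0 X1 X2 X3 Y0 Y1 Y2 Y3 :
  row4 X0 X1 X2 X3 = row4 Y0 Y1 Y2 Y3 -> [/\ X0 = Y0, X1 = Y1, X2 = Y2 & X3 = Y3].
Proof.
move=> /rowP XY; split;
  [have := XY 0|have := XY 1|have := XY 2|have := XY 3]; by rewrite !mxE.
Qed.

Lemma CP3_default_neq0 : row4 1 0 0 0 != 0.
Proof. by rewrite row4_eq0 oner_eq0. Qed.

Definition CP3_default : CP3_pre R :=
  exist (fun X : 'rV[C]_4 => X != 0) _ CP3_default_neq0.

(** The point with the given homogeneous coordinates; the zero vector is sent
    to the default point [1, 0, 0, 0]. *)
Definition CP3_pt (X0 X1 X2 X3 : C) : CP3 R :=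
  \pi_(CP3 R) (insubd CP3_default (row4 X0 X1 X2 X3)).

Lemma CP3_ptP (x : CP3 R) : exists X0 X1 X2 X3,
  row4 X0 X1 X2 X3 != 0 /\ x = CP3_pt X0 X1 X2 X3.
Proof.
pose X := repr x; have X_neq0 := valP X; rewrite [val X]row4E in X_neq0.
do 4!eexists; split; first exact: X_neq0.
rewrite -[LHS]reprK; apply: congr1.
by apply: val_inj; rewrite val_insubd X_neq0 -row4E.
Qed.

Lemma CP3_pt_eq X0 X1 X2 X3 Y0 Y1 Y2 Y3 :
  row4 X0 X1 X2 X3 != 0 -> row4 Y0 Y1 Y2 Y3 != 0 ->
  CP3_pt X0 X1 X2 X3 = CP3_pt Y0 Y1 Y2 Y3 <->
  exists2 l, l != 0 & [/\ Y0 = l * X0, Y1 = l * X1, Y2 = l * X2 & Y3 = l * X3].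
Proof.
move=> Xn0 Yn0; split.
  move=> /eqmodP/asboolP[l l0]; rewrite !val_insubd Xn0 Yn0 row4Z => /row4_inj.
  by exists l.
move=> [l l0 [Y0E Y1E Y2E Y3E]]; apply/eqmodP/asboolP; exists l => //.
by rewrite !val_insubd Xn0 Yn0 row4Z Y0E Y1E Y2E Y3E.
Qed.

Lemma cubic_scroll_pt X0 X1 X2 X3 : row4 X0 X1 X2 X3 != 0 ->
  cubic_scroll R (CP3_pt X0 X1 X2 X3) <-> X0 * X3 ^+ 2 + X1 ^+ 2 * X2 = 0.
Proof.
move=> Xn0; split.
  move=> [Y /esym/eqmodP/asboolP[l l0]].
  rewrite val_insubd Xn0 [val Y]row4E row4Z => /row4_inj[-> -> -> ->].
  rewrite -row4E => eq0.
  set y0 := val Y 0 0 in eq0 *; set y1 := val Y 0 1 in eq0 *.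
  set y2 := val Y 0 2 in eq0 *; set y3 := val Y 0 3 in eq0 *.
  have -> : l * y0 * (l * y3) ^+ 2 + (l * y1) ^+ 2 * (l * y2)
    = l ^+ 3 * (y0 * y3 ^+ 2 + y1 ^+ 2 * y2) by ring.
  by rewrite eq0 mulr0.
by move=> X0E; eexists; first by []; rewrite val_insubd Xn0 /= !mxE.
Qed.

(** The point a + b j. *)
Definition S4pt a b : S4 R :=
  Some (complex.Re a, complex.Im a, complex.Re b, complex.Im b).

Lemma quatCE a b :
  quatC a + quatC b * quatj = (complex.Re a, complex.Im a, complex.Re b, complex.Im b) :> quat R.
Proof. by case: a b => [a1 a2] [b1 b2]; congr (_, _, _, _); rewrite /=; ring. Qed.

(** Uses j z = z' j, for z in C_i with conjugate z'. *)
Lemma quatC_mul X0 X1 a b :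
  (quatC X0 + quatC X1 * quatj) * (quatC a + quatC b * quatj) =
  quatC (X0 * a - X1 * b^*) + quatC (X0 * b + X1 * a^*) * quatj :> quat R.
Proof.
rewrite !quatCE; case: a b X0 X1 => [a1 a2] [b1 b2] [x1 x2] [y1 y2].
by congr (_, _, _, _); rewrite /=; ring.
Qed.

Lemma quatC_inj X0 X1 Y0 Y1 :
  quatC X0 + quatC X1 * quatj = quatC Y0 + quatC Y1 * quatj :> quat R ->
  X0 = Y0 /\ X1 = Y1.
Proof.
rewrite !quatCE; case: X0 X1 Y0 Y1 => [a1 a2] [b1 b2] [x1 x2] [y1 y2] /=.
by move=> [-> -> -> ->].
Qed.

Lemma HP1_eqP (u v : HP1_pre R) : \pi_(HP1 R) u = \pi_(HP1 R) v <->
  exists2 p : quat R, p != 0 & val v = (p * (val u).1, p * (val u).2).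
Proof. by split=> [/eqmodP/asboolP|uv] //; apply/eqmodP/asboolP. Qed.

Lemma twistor_coord_pt X0 X1 X2 X3 : row4 X0 X1 X2 X3 != 0 ->
  twistor_coord (val (insubd CP3_default (row4 X0 X1 X2 X3)))
  = (quatC X0 + quatC X1 * quatj, quatC X2 + quatC X3 * quatj).
Proof. by move=> Xn0; rewrite val_insubd Xn0 /twistor_coord !mxE. Qed.

Lemma fibre_pt X0 X1 X2 X3 a b : row4 X0 X1 X2 X3 != 0 ->
  fibre (S4pt a b) (CP3_pt X0 X1 X2 X3) <->
  X2 = X0 * a - X1 * b^* /\ X3 = X0 * b + X1 * a^*.
Proof.
move=> Xn0; have XE := twistor_coord_pt _ _ _ _ Xn0.
rewrite /fibre /= /CP3_pt twistorE /S4_HP1 /S4pt; split.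
  move=> /esym/HP1_eqP[p p0]; rewrite [val _]XE /= mulr1 => -[<-].
  by rewrite -quatCE quatC_mul => /quatC_inj.
move=> [X2E X3E]; apply/esym/HP1_eqP; exists (quatC X0 + quatC X1 * quatj).
  apply: contra Xn0 => /eqP/quatCDj_eq0[X00 X10].
  by rewrite row4_eq0 X2E X3E X00 X10 !mul0r subr0 addr0 eqxx.
by rewrite [val _]XE /= mulr1 -quatCE quatC_mul -X2E -X3E.
Qed.

Lemma fibre_oo_pt X0 X1 X2 X3 : row4 X0 X1 X2 X3 != 0 ->
  fibre S4oo (CP3_pt X0 X1 X2 X3) <-> X0 = 0 /\ X1 = 0.
Proof.
move=> Xn0; have XE := twistor_coord_pt _ _ _ _ Xn0.
rewrite /fibre /= /CP3_pt twistorE /S4_HP1; split.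
  move=> /esym/HP1_eqP[p p0]; rewrite [val _]XE /= mulr0 => /(congr1 fst).
  exact: quatCDj_eq0.
move=> [X00 X10]; apply/esym/HP1_eqP; exists (quatC X2 + quatC X3 * quatj).
  apply: contra Xn0 => /eqP/quatCDj_eq0[X20 X30].
  by rewrite row4_eq0 X00 X10 X20 X30 eqxx.
by rewrite [val _]XE /= mulr1 mulr0 X00 X10 quatCE.
Qed.

Lemma inj_infinite_set {T : Type} (A : set T) (f : nat -> T) :
  injective f -> (forall n, A (f n)) -> infinite_set A.
Proof.
move=> f_inj Af /finite_preimage finA; apply: infinite_nat.
by apply: sub_finite_set (finA _ f _) => [n _|m n _ _ /f_inj //]; exact: Af.
Qed.

(** A fibre is a projective line, hence infinite: this separates the fibres
    contained in the surface from those that meet it in a finite set. *)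
Lemma fibre_infinite q : infinite_set (fibre q).
Proof.
case: q => [[[[a1 a2] b1] b2]|].
  pose a := a1 +i* a2; pose b := b1 +i* b2.
  pose f (n : nat) := CP3_pt n%:R 1 (n%:R * a - 1 * b^*) (n%:R * b + 1 * a^*).
  have n0 n : row4 n%:R 1 (n%:R * a - 1 * b^*) (n%:R * b + 1 * a^*) != 0.
    by rewrite row4_eq0 oner_eq0 andbF.
  apply: (@inj_infinite_set _ _ f); last by move=> n; apply/(fibre_pt _ _ _ _ a b).
  move=> m n /(CP3_pt_eq _ _ _ _ _ _ _ _ (n0 m) (n0 n))[l _ [nE]].
  rewrite mulr1 => l1 _ _; move: nE; rewrite -l1 mul1r => /eqP.
  by rewrite eqr_nat => /eqP.
have n0 n : row4 0 0 n%:R 1 != 0 by rewrite row4_eq0 oner_eq0 !andbF.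
apply: (@inj_infinite_set _ _ (fun n => CP3_pt 0 0 n%:R 1)); last first.
  by move=> n; apply/fibre_oo_pt.
move=> m n /(CP3_pt_eq _ _ _ _ _ _ _ _ (n0 m) (n0 n))[l _ [_ _ nE]].
by rewrite mulr1 => l1; move: nE; rewrite -l1 mul1r => /eqP; rewrite eqr_nat => /eqP.
Qed.

Lemma fibre_oo_sub : fibre S4oo `<=` cubic_scroll R.
Proof.
move=> x; have [X0 [X1 [X2 [X3 [Xn0 ->]]]]] := CP3_ptP x.
move=> /(fibre_oo_pt _ _ _ _ Xn0)[X00 X10]; apply/(cubic_scroll_pt _ _ _ _ Xn0).
by rewrite X00 X10 expr0n /= !mul0r addr0.
Qed.

Lemma fibre_cubic_pt X0 X1 X2 X3 a b : row4 X0 X1 X2 X3 != 0 ->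
  (fibre (S4pt a b) `&` cubic_scroll R) (CP3_pt X0 X1 X2 X3) <->
  [/\ X2 = X0 * a - X1 * b^*, X3 = X0 * b + X1 * a^* &
    b ^+ 2 * X0 ^+ 3 + 2 * b * a^* * X0 ^+ 2 * X1
    + (a^* ^+ 2 + a) * X0 * X1 ^+ 2 - b^* * X1 ^+ 3 = 0].
Proof.
move=> Xn0; rewrite /setI /= (fibre_pt _ _ _ _ a b Xn0) (cubic_scroll_pt _ _ _ _ Xn0).
have cubicE : X0 * (X0 * b + X1 * a^*) ^+ 2 + X1 ^+ 2 * (X0 * a - X1 * b^*) =
    b ^+ 2 * X0 ^+ 3 + 2 * b * a^* * X0 ^+ 2 * X1
    + (a^* ^+ 2 + a) * X0 * X1 ^+ 2 - b^* * X1 ^+ 3 by ring.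
by split=> [[[-> ->]]|[-> ->]]; rewrite cubicE.
Qed.

Lemma fibre_C_sub a : a^* ^+ 2 + a = 0 ->
  fibre (S4pt a 0) `<=` cubic_scroll R.
Proof.
move=> a0 x; have [X0 [X1 [X2 [X3 [Xn0 ->]]]]] := CP3_ptP x.
move=> fib; suff [] :
  (fibre (S4pt a 0) `&` cubic_scroll R) (CP3_pt X0 X1 X2 X3) by [].
apply/(fibre_cubic_pt _ _ _ _ a 0 Xn0).
have [-> ->] := (fibre_pt _ _ _ _ a 0 Xn0).1 fib; split=> //.
by rewrite a0 conjC0; ring.
Qed.

Lemma fibre_C_card a : a^* ^+ 2 + a <> 0 ->
  fibre (S4pt a 0) `&` cubic_scroll R #= `I_2.
Proof.
move=> /eqP a0.
have n0 : row4 1 0 a 0 != 0 by rewrite row4_eq0 oner_eq0.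
have n1 : row4 0 1 0 (a^*) != 0 by rewrite row4_eq0 oner_eq0 andbF.
have -> : fibre (S4pt a 0) `&` cubic_scroll R =
    [set CP3_pt 1 0 a 0; CP3_pt 0 1 0 (a^*)].
  apply/seteqP; split=> x; last first.
    case=> ->; apply/(fibre_cubic_pt _ _ _ _ a 0) => //; rewrite conjC0;
      split; ring.
  have [X0 [X1 [X2 [X3 [Xn0 ->]]]]] := CP3_ptP x.
  move=> /(fibre_cubic_pt _ _ _ _ a 0 Xn0)[X2E X3E].
  rewrite conjC0 expr0n /= !(mulr0, mul0r, add0r, subr0).
  move=> /eqP; rewrite !mulf_eq0 (negPf a0) /= => /orP[|] X0E; [right|left].
    have {X0E}X00 : X0 = 0 by apply/eqP.
    apply/esym/(CP3_pt_eq _ _ _ _ _ _ _ _ n1 Xn0).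
    move: X2E X3E; rewrite X00 conjC0 mulr0 !mul0r subr0 add0r => X2E X3E.
    exists X1; last by rewrite X2E X3E !mulr0 mulr1.
    by apply: contra Xn0 => /eqP X10; rewrite row4_eq0 X2E X3E X00 X10 mul0r eqxx.
  have X10 : X1 = 0 by move: X0E => /orP[] /eqP.
  apply/esym/(CP3_pt_eq _ _ _ _ _ _ _ _ n0 Xn0).
  move: X2E X3E; rewrite X10 conjC0 !mulr0 !mul0r subr0 addr0 => X2E X3E.
  exists X0; last by rewrite X2E X3E !mulr0 mulr1.
  by apply: contra Xn0 => /eqP X00; rewrite row4_eq0 X2E X3E X00 X10 mul0r eqxx.
apply: card_set2 => /(CP3_pt_eq _ _ _ _ _ _ _ _ n0 n1)[l _ [_ /eqP]].
by rewrite mulr0 oner_eq0.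
Qed.

(** For b != 0 no point of the surface over a + b j has X1 = 0, so y = b X0 / X1
    is a coordinate there.  The factor b makes the cubic monic with
    coefficients that depend on b only through its norm. *)
Lemma fibre_cubic_roots a b : b != 0 ->
  fibre (S4pt a b) `&` cubic_scroll R #=
  cubic_roots (2 * a^*) (a^* ^+ 2 + a) (- (b * b^*)).
Proof.
move=> b0; pose f y := CP3_pt (y / b) 1 (y / b * a - b^*) (y + a^*).
have n0 y : row4 (y / b) 1 (y / b * a - b^*) (y + a^*) != 0.
  by rewrite row4_eq0 oner_eq0 andbF.
suff -> : fibre (S4pt a b) `&` cubic_scroll R =
    f @` cubic_roots (2 * a^*) (a^* ^+ 2 + a) (- (b * b^*)).
  apply: inj_card_eq => y z _ _ /(CP3_pt_eq _ _ _ _ _ _ _ _ (n0 y) (n0 z)).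
  move=> [l _ [zE l1 _ _]]; move: zE; rewrite -[l]mulr1 -l1 mul1r.
  by move=> /(divIf b0).
apply/seteqP; split=> [x|_ [y yE <-]]; last first.
  apply/(fibre_cubic_pt _ _ _ _ a b) => //; split; rewrite ?mul1r ?divfK //.
  by rewrite -[RHS](mul0r b^-1) -yE /=; field.
have [X0 [X1 [X2 [X3 [Xn0 ->]]]]] := CP3_ptP x.
move=> /(fibre_cubic_pt _ _ _ _ a b Xn0)[X2E X3E eq0].
have X1n0 : X1 != 0.
  apply: contra Xn0 => /eqP X1E; move: eq0; rewrite X1E.
  rewrite !expr0n /= !mulr0 subr0 !addr0 => /eqP.
  rewrite mulf_eq0 !expf_eq0 /= (negPf b0) => /eqP X0E.
  by rewrite row4_eq0 X2E X3E X0E X1E !mul0r subr0 addr0 eqxx.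
exists (X0 * b / X1); last first.
  apply/CP3_pt_eq => //; exists X1 => //; rewrite X2E X3E.
  by split; rewrite ?mulr1 //; field; rewrite ?b0.
rewrite /cubic_roots /=.
transitivity ((b ^+ 2 * X0 ^+ 3 + 2 * b * a^* * X0 ^+ 2 * X1
    + (a^* ^+ 2 + a) * X0 * X1 ^+ 2 - b^* * X1 ^+ 3) * (b / X1 ^+ 3)).
  by field; rewrite X1n0.
by rewrite eq0 mul0r.
Qed.

(** * The handles *)

Definition height p : R := Num.sqrt (height2 p).

(** The cylinder has its end 0 at P: the parameter p runs over (0, 1) for P = 0
    and over (1, oo), backwards, for P = oo. *)
Definition handle_param P t : R := if P is Some _ then t else t^-1.

Definition handle_pt z (r s u1 u2 : R) : S4 R :=
  Some (r * complex.Re z, r * complex.Im z, s * u1, s * u2).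

Definition handle_map P z (x : R * R * R) : S4 R :=
  let p := handle_param P x.2 in
  handle_pt z (ray p) (height p) x.1.1 x.1.2.

Definition handle_surface P z : set (S4 R) :=
  [set P; S4C z] `|` handle_map P z @` @cylinder R.

(** A left inverse of [handle_map P z], the same for all z: |a| gives p, and
    b / |b| is the point of the circle. *)
Definition handle_inv P (q : S4 R) : R * R * R :=
  if q is Some (a1, a2, b1, b2) then
    let s := Num.sqrt (b1 ^+ 2 + b2 ^+ 2) in
    (b1 / s, b2 / s, handle_param P (ray_inv (Num.sqrt (a1 ^+ 2 + a2 ^+ 2))))
  else 0.

Lemma ray_continuous p : 0 <= p -> {for p, continuous ray}.
Proof.
move=> p0; apply: cvgM.
  by apply: cvgM; [exact: cvg_cst|exact: exprn_continuous].
by apply: cvgV; [lra|apply: cvgD; [exact: cvg_cst|apply: cvgM; [exact: cvg_cst|]]].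
Qed.

Lemma height_continuous p : 0 <= p -> {for p, continuous height}.
Proof.
move=> p0; apply: (@continuous_comp _ _ _ height2 Num.sqrt); last first.
  exact: sqrt_continuous.
apply: cvgM.
  apply: cvgM; first by apply: cvgM; [exact: cvg_cst|exact: exprn_continuous].
  apply: (@continuous_comp _ _ _ (fun p => 1 - p) (fun x => x ^+ 2)).
    by apply: cvgB; [exact: cvg_cst|].
  exact: exprn_continuous.
apply: cvgV; first by rewrite expf_neq0 //; lra.
apply: (@continuous_comp _ _ _ (fun p => 1 + 2 * p) (fun x => x ^+ 2)).
  by apply: cvgD; [exact: cvg_cst|apply: cvgM; [exact: cvg_cst|]].
exact: exprn_continuous.
Qed.

Lemma ray_inv_continuous t : {for t, continuous ray_inv}.
Proof.
apply: cvgM; last exact: cvg_cst.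
apply: cvgD; first by [].
apply: (@continuous_comp _ _ _ (fun t => t ^+ 2 + 3 * t) Num.sqrt); last first.
  exact: sqrt_continuous.
apply: cvgD; first exact: exprn_continuous.
by apply: cvgM; [exact: cvg_cst|].
Qed.

Lemma handle_param_continuous P t : 0 < t -> {for t, continuous (handle_param P)}.
Proof.
by move=> t0; rewrite /handle_param; case: P => [_|]; [|apply: cvgV => //; lra].
Qed.

Lemma handle_param_gt0 P t : 0 < t -> 0 < handle_param P t.
Proof. by case: P => [_|] //=; rewrite invr_gt0. Qed.

Lemma handle_paramK P : involutive (handle_param P).
Proof. by case: P => [_|] t //=; rewrite invrK. Qed.

Lemma handle_param_neq1 P t : t != 1 -> handle_param P t != 1.
Proof. by case: P => [_|] //=; rewrite invr_eq1. Qed.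

Lemma height_gt0 p : 0 < p -> p != 1 -> 0 < height p.
Proof. by move=> p0 p1; rewrite sqrtr_gt0 height2_gt0. Qed.

Lemma handle_map_continuous P z x : 0 < x.2 -> {for x, continuous (handle_map P z)}.
Proof.
move=> x0; set p := handle_param P x.2.
have p0 : 0 < p by exact: handle_param_gt0.
have cp : {for x, continuous (fun x : R * R * R => handle_param P x.2)}.
  by apply: continuous_comp; [exact: cvg_snd|exact: handle_param_continuous].
have cr : {for x, continuous (fun x : R * R * R => ray (handle_param P x.2))}.
  by apply: continuous_comp => //; apply: ray_continuous; exact: ltW.
have cs : {for x, continuous (fun x : R * R * R => height (handle_param P x.2))}.
  by apply: continuous_comp => //; apply: height_continuous; exact: ltW.
have c1 : {for x, continuous (fun x : R * R * R => x.1)} by exact: cvg_fst.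
have c11 : {for x, continuous (fun x : R * R * R => x.1.1)}.
  by apply: (continuous_comp c1); exact: cvg_fst.
have c12 : {for x, continuous (fun x : R * R * R => x.1.2)}.
  by apply: (continuous_comp c1); exact: cvg_snd.
rewrite /handle_map /handle_pt.
apply: (@continuous_comp _ _ _ _ (Some : quat R -> S4 R)); last first.
  exact: one_point_compactification_some_continuous.
apply: (@cvg_pair _ _ _ _ (nbhs _) (nbhs _)); last by apply: cvgM.
apply: (@cvg_pair _ _ _ _ (nbhs _) (nbhs _)); last by apply: cvgM.
apply: (@cvg_pair _ _ _ _ (nbhs _) (nbhs _)); by apply: cvgM => //; exact: cvg_cst.
Qed.

Lemma handle_inv_continuous P (a1 a2 b1 b2 : R) :
  0 < a1 ^+ 2 + a2 ^+ 2 -> 0 < b1 ^+ 2 + b2 ^+ 2 ->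
  {for (Some (a1, a2, b1, b2) : S4 R), continuous (handle_inv P)}.
Proof.
move=> a0 b0; pose q : R * R * R * R := (a1, a2, b1, b2).
suff : {for q, continuous (fun q : R * R * R * R => handle_inv P (Some q))} by [].
have ca : {for q, continuous (fun q : R * R * R * R => q.1.1)}.
  by apply: continuous_comp; exact: cvg_fst.
have ca1 : {for q, continuous (fun q : R * R * R * R => q.1.1.1)}.
  by apply: (continuous_comp ca); exact: cvg_fst.
have ca2 : {for q, continuous (fun q : R * R * R * R => q.1.1.2)}.
  by apply: (continuous_comp ca); exact: cvg_snd.
have cb1 : {for q, continuous (fun q : R * R * R * R => q.1.2)}.
  by apply: continuous_comp; [exact: cvg_fst|exact: cvg_snd].
have cb2 : {for q, continuous (fun q : R * R * R * R => q.2)} by exact: cvg_snd.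
have cn (f g : R * R * R * R -> R) : {for q, continuous f} -> {for q, continuous g} ->
    {for q, continuous (fun q : R * R * R * R => Num.sqrt (f q ^+ 2 + g q ^+ 2))}.
  move=> cf cg; apply: (@continuous_comp _ _ _ (fun q : R * R * R * R => f q ^+ 2 + g q ^+ 2)).
    apply: cvgD.
      by apply: (@continuous_comp _ _ _ f (fun x => x ^+ 2)) => //; exact: exprn_continuous.
    by apply: (@continuous_comp _ _ _ g (fun x => x ^+ 2)) => //; exact: exprn_continuous.
  exact: sqrt_continuous.
have cs := cn _ _ cb1 cb2.
have s0 : Num.sqrt (q.1.2 ^+ 2 + q.2 ^+ 2) != 0 by rewrite gt_eqF // sqrtr_gt0.
have ct : {for q, continuous (fun q : R * R * R * R =>
    handle_param P (ray_inv (Num.sqrt (q.1.1.1 ^+ 2 + q.1.1.2 ^+ 2))))}.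
  apply: (@continuous_comp _ _ _ _ (handle_param P)); last first.
    by apply: handle_param_continuous; rewrite ray_inv_gt0 // sqrtr_gt0.
  apply: (@continuous_comp _ _ _ _ ray_inv); last exact: ray_inv_continuous.
  exact: cn.
have -> : (fun q : R * R * R * R => handle_inv P (Some q)) = (fun q : R * R * R * R =>
  let s := Num.sqrt (q.1.2 ^+ 2 + q.2 ^+ 2) in (q.1.2 / s, q.2 / s,
   handle_param P (ray_inv (Num.sqrt (q.1.1.1 ^+ 2 + q.1.1.2 ^+ 2))))).
  by apply/funext => -[[[? ?] ?] ?].
apply: (@cvg_pair _ _ _ _ (nbhs _) (nbhs _)) => //.
by apply: (@cvg_pair _ _ _ _ (nbhs _) (nbhs _)); apply: cvgM => //; apply: cvgV.
Qed.

Lemma circle_le1 (u v : R) : u ^+ 2 + v ^+ 2 = 1 -> `|u| <= 1 /\ `|v| <= 1.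
Proof. by move=> uv; rewrite !ler_norml; split; apply/andP; split; nra. Qed.

(** A family of circles whose centre converges and whose radius tends to 0 is
    eventually contained in any neighbourhood of the limit of the centre. *)
Lemma collapse_end (F : set_system R) {FF : Filter F} (r s : R -> R) r0 z U :
  r t @[t --> F] --> r0 -> s t @[t --> F] --> 0 ->
  nbhs (handle_pt z r0 0 0 0) U ->
  \forall t \near F, forall u1 u2, u1 ^+ 2 + u2 ^+ 2 = 1 ->
    U (handle_pt z (r t) (s t) u1 u2).
Proof.
move=> rF sF.
have zF c : r t * c @[t --> F] --> r0 * c by apply: cvgM => //; exact: cvg_cst.
move=> /(@nbhs_ballP R (quat R))[e /= e0 eU].
have zb c : \forall t \near F, ball (r0 * c : R) e (r t * c).
  have /cvgrPdist_lt/(_ e e0) := zF c.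
  by apply: filterS => t; rewrite -ball_normE.
near=> t => u1 u2 u12; apply: eU; rewrite /ball /=.
have [u1_le1 u2_le1] := circle_le1 _ _ u12.
have st : `|s t| < e.
  near: t; have /cvgrPdist_lt/(_ e e0) := sF.
  by apply: filterS => t; rewrite sub0r normrN.
have su (u : R) : `|u| <= 1 -> ball (0 * 0 : R) e (s t * u).
  rewrite -ball_normE /ball_ /= mul0r sub0r normrN normrM => u_le1.
  by apply: le_lt_trans st; rewrite ler_piMr.
split; last exact: su.
split; last exact: su.
by split=> /=; near: t; exact: zb.
Unshelve. all: by end_near. Qed.

(** A compact subset of H is bounded, so that a neighbourhood of oo contains
    all points a + b j with |a| large. *)
Lemma nbhs_oo (U : set (S4 R)) : nbhs S4oo U ->
  exists M : R, forall a1 a2 b1 b2 : R,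
    M < a1 ^+ 2 + a2 ^+ 2 -> U (Some (a1, a2, b1, b2)).
Proof.
move=> [K [cK _] KU]; pose f (q : quat R) := q.1.1.1 ^+ 2 + q.1.1.2 ^+ 2.
have cf : continuous f.
  move=> q.
  have ca : {for q, continuous (fun q : R * R * R * R => q.1.1)}.
    by apply: continuous_comp; exact: cvg_fst.
  apply: cvgD.
    apply: (@continuous_comp _ _ _ (fun q : R * R * R * R => q.1.1.1)
      (fun x => x ^+ 2)); last exact: exprn_continuous.
    by apply: (continuous_comp ca); exact: cvg_fst.
  apply: (@continuous_comp _ _ _ (fun q : R * R * R * R => q.1.1.2)
      (fun x => x ^+ 2)); last exact: exprn_continuous.
  by apply: (continuous_comp ca); exact: cvg_snd.
have : compact (f @` K).
  by apply: continuous_compact => //; exact: continuous_subspaceT.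
move=> /compact_bounded/pinfty_ex_gt0[M M0 MK].
exists M => a1 a2 b1 b2 Ma; apply: KU; left; exists (a1, a2, b1, b2) => // Kq.
have := MK _ (imageP f Kq); rewrite /f /= ger0_norm ?addr_ge0 ?sqr_ge0 //.
by rewrite leNgt Ma.
Qed.

Lemma ray0 : ray 0 = 0. Proof. by rewrite /ray expr0n /= mulr0 mul0r. Qed.
Lemma ray1 : ray 1 = 1. Proof. by rewrite /ray; field. Qed.
Lemma height0 : height 0 = 0.
Proof. by rewrite /height /height2 expr0n /= mulr0 !mul0r sqrtr0. Qed.
Lemma height1 : height 1 = 0.
Proof. by rewrite /height /height2 subrr expr0n /= mulr0 mul0r sqrtr0. Qed.

Lemma handle_end_root P z (U : set (S4 R)) : nbhs (S4C z) U ->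
  \forall t \near 1^'-, forall u, cylinder (u, t) -> U (handle_map P z (u, t)).
Proof.
move=> zU.
have cp : {for 1, continuous (handle_param P)} by exact: handle_param_continuous.
have p1 : handle_param P 1 = 1 by case: (P) => [_|] //=; rewrite invr1.
have cr : ray (handle_param P t) @[t --> 1^'-] --> (1 : R).
  have : {for 1, continuous (ray \o handle_param P)}.
    by apply: (continuous_comp cp); rewrite p1; exact: ray_continuous.
  by move=> /cvg_at_left_filter; rewrite /= p1 ray1.
have cs : height (handle_param P t) @[t --> 1^'-] --> (0 : R).
  have : {for 1, continuous (height \o handle_param P)}.
    by apply: (continuous_comp cp); rewrite p1; exact: height_continuous.
  by move=> /cvg_at_left_filter; rewrite /= p1 height1.
have := collapse_end _ _ _ 1 z U cr cs.
have -> : handle_pt z 1 0 0 0 = S4C z.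
  by rewrite /handle_pt /S4C; case: (z) => a b /=; rewrite !mul1r mul0r.
by move=> /(_ _ zU); apply: filterS => t tU u [/= u1 _]; exact: tU.
Qed.

Lemma handle_end_zero z (U : set (S4 R)) : nbhs (S4C 0 : S4 R) U ->
  \forall t \near 0^'+, forall u, cylinder (u, t) -> U (handle_map (S4C 0) z (u, t)).
Proof.
move=> zU.
have cr : ray t @[t --> 0^'+] --> (0 : R).
  by rewrite -[X in _ --> X]ray0; apply: cvg_at_right_filter; exact: ray_continuous.
have cs : height t @[t --> 0^'+] --> (0 : R).
  by rewrite -[X in _ --> X]height0; apply: cvg_at_right_filter; exact: height_continuous.
have := collapse_end _ _ _ 0 z U cr cs.
have -> : handle_pt z 0 0 0 0 = S4C 0 by rewrite /handle_pt /S4C !mul0r.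
by move=> /(_ _ zU); apply: filterS => t tU u [/= u1 _]; exact: tU.
Qed.

(** For p = 1 / t with t < 1, |a| = 3 / (t (t + 2)) is at least 1 / t. *)
Lemma handle_end_oo z (U : set (S4 R)) :
  complex.Re z ^+ 2 + complex.Im z ^+ 2 = 1 -> nbhs (S4oo : S4 R) U ->
  \forall t \near 0^'+, forall u, cylinder (u, t) -> U (handle_map S4oo z (u, t)).
Proof.
move=> z1 /nbhs_oo[M MU]; pose N := Num.max M 1 + 1.
have MN : M + 1 <= N by rewrite lerD2r le_max lexx.
have N1 : 2 <= N by rewrite [leLHS](_ : _ = 1 + 1) // lerD2r le_max lexx orbT.
have N0 : 0 < N by lra.
near=> t => u [_ /= /andP[t0 t1]]; apply: MU.
have tN : t * N < 1.
  rewrite -ltr_pdivlMr //; near: t; apply: nbhs_right_lt; exact: divr_gt0.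
have rE : ray t^-1 = 3 / (t * (t + 2)).
  by rewrite /ray; field; rewrite !gt_eqF //; lra.
have rN : N <= ray t^-1.
  rewrite rE ler_pdivlMr ?mulr_gt0 //; last by lra.
  nra.
rewrite /=; move: (ray t^-1) rN => r rN.
have -> : (r * complex.Re z) ^+ 2 + (r * complex.Im z) ^+ 2 = r ^+ 2.
  by rewrite -[RHS]mulr1 -z1; ring.
by apply: (lt_le_trans (y := r)); rewrite ?ler_eXnr //; lra.
Unshelve. all: by end_near. Qed.

Lemma scale_circle (r u1 u2 : R) : u1 ^+ 2 + u2 ^+ 2 = 1 ->
  (r * u1) ^+ 2 + (r * u2) ^+ 2 = r ^+ 2.
Proof. by move=> u; rewrite -[RHS]mulr1 -u; ring. Qed.

Lemma sqrt_circle (r u1 u2 : R) : 0 <= r -> u1 ^+ 2 + u2 ^+ 2 = 1 ->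
  Num.sqrt ((r * u1) ^+ 2 + (r * u2) ^+ 2) = r.
Proof. by move=> r0 u; rewrite scale_circle // sqrtr_sqr ger0_norm. Qed.

Lemma handle_map_gt0 P z x : z ^+ 3 = -1 -> cylinder x ->
  [/\ 0 < handle_param P x.2, handle_param P x.2 != 1,
     0 < ray (handle_param P x.2) & 0 < height (handle_param P x.2)].
Proof.
move=> z3 [u /andP[t0 t1]].
have p0 : 0 < handle_param P x.2 by exact: handle_param_gt0.
have p1 : handle_param P x.2 != 1 by apply: handle_param_neq1; rewrite lt_eqF.
by split=> //; [exact: ray_gt0|exact: height_gt0].
Qed.

Lemma handle_mapK P z x : z ^+ 3 = -1 -> cylinder x ->
  handle_inv P (handle_map P z x) = x.
Proof.
move=> z3 cx; have [p0 p1 r0 s0] := handle_map_gt0 P z x z3 cx.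
case: cx => u _; case: x u p0 p1 r0 s0 => [[u1 u2] t] /= u p0 p1 r0 s0.
rewrite !sqrt_circle ?(norm_root _ z3) ?ltW // rayK // handle_paramK.
by congr (_, _, _); rewrite mulrC mulKf // gt_eqF.
Qed.

Lemma handle_map_notin_hatC P z x : z ^+ 3 = -1 -> cylinder x ->
  ~ hatC R (handle_map P z x).
Proof.
move=> z3 cx; have [_ _ _ s0] := handle_map_gt0 P z x z3 cx.
case: cx => u _ [[[c1 c2] _ /= [_ _ c3 c4]]|//].
have : (height (handle_param P x.2) * x.1.1) ^+ 2
   + (height (handle_param P x.2) * x.1.2) ^+ 2 = 0.
  by rewrite -c3 -c4 expr0n addr0.
by rewrite (scale_circle _ _ _ u) => /eqP; rewrite sqrf_eq0 gt_eqF.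
Qed.

Lemma hatC_ends P z : handle_ends R P -> [set P; S4C z] `<=` hatC R.
Proof.
by move=> [->|->] _ [->|->]; [left; exists 0|left; exists z|right|left; exists z].
Qed.

Lemma handle_hatC P z : handle_ends R P -> z ^+ 3 = -1 ->
  handle_surface P z `&` hatC R = [set P; S4C z].
Proof.
move=> HP z3; apply/seteqP; split=> [q [[//|[x cx <-]]]|q qe].
  by move=> /(handle_map_notin_hatC _ _ _ z3 cx).
by split; [left|exact: hatC_ends qe].
Qed.

Lemma handle_open P z : handle_ends R P -> z ^+ 3 = -1 ->
  handle_surface P z `\` [set P; S4C z] = handle_map P z @` @cylinder R.
Proof.
move=> HP z3; apply/seteqP; split=> [q [[//|//]]|_ [x cx <-]].
split; first by right; exists x.
by move=> /(hatC_ends _ z HP); exact: handle_map_notin_hatC.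
Qed.

(** The maps [handle_map] and [handle_inv] are continuous where a and b do not
    vanish, which is the case on the open handles. *)
Lemma handle_surface_pinched P z : handle_ends R P -> z ^+ 3 = -1 ->
  pinched_handle P (S4C z) (handle_surface P z).
Proof.
move=> HP z3; split; [by left; left|by left; right|exact: handle_hatC|].
exists (handle_map P z), (handle_inv P); split.
- apply: continuous_in_subspaceT => x /set_mem[_ /andP[x0 _]].
  exact: handle_map_continuous.
- rewrite handle_open //; apply: continuous_in_subspaceT => _ /set_mem[x cx <-].
  have [p0 p1 r0 s0] := handle_map_gt0 P z x z3 cx.
  case: cx => u _; apply: handle_inv_continuous.
    by rewrite (scale_circle _ _ _ (norm_root _ z3)) exprn_gt0.
  by rewrite (scale_circle _ _ _ u) exprn_gt0.
- by rewrite handle_open.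
- by move=> x; exact: handle_mapK.
split=> U; last exact: handle_end_root.
case: HP => ->; first exact: handle_end_zero.
by apply: handle_end_oo; exact: norm_root.
Qed.

(** The coordinate a = t z determines t > 0 and z, hence p, and P is told by
    p < 1 or p > 1. *)
Lemma handle_map_inj P z P' z' x x' :
  handle_ends R P -> handle_ends R P' -> z ^+ 3 = -1 -> z' ^+ 3 = -1 ->
  cylinder x -> cylinder x' -> handle_map P z x = handle_map P' z' x' ->
  (P, z) = (P', z').
Proof.
move=> HP HP' z3 z3' cx cx' xx'.
have [p0 p1 r0 s0] := handle_map_gt0 P z x z3 cx.
have [p0' p1' r0' s0'] := handle_map_gt0 P' z' x' z3' cx'.
case: xx' => a1E a2E _ _.
have rE : ray (handle_param P x.2) = ray (handle_param P' x'.2).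
  rewrite -(sqrt_circle _ _ _ (ltW r0) (norm_root _ z3)) a1E a2E.
  by rewrite (sqrt_circle _ _ _ (ltW r0') (norm_root _ z3')).
have pE : handle_param P x.2 = handle_param P' x'.2 by rewrite -[LHS]rayK // rE rayK.
congr (_, _); last first.
  move: a1E a2E; rewrite rE => /(mulfI (lt0r_neq0 r0')) + /(mulfI (lt0r_neq0 r0')).
  by case: (z) (z') => a b [c d] /= -> ->.
case: cx cx' => _ /andP[t0 t1] [_ /andP[t0' t1']]; move: pE.
have i1 (t : R) : 0 < t -> t < 1 -> 1 < t^-1 by move=> *; rewrite invf_gt1.
case: HP HP' => -> [] -> //= pE.
  by have := i1 _ t0' t1'; rewrite -pE ltNge (ltW t1).
by have := i1 _ t0 t1; rewrite pE ltNge (ltW t1').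
Qed.

Lemma handle_disjoint P z P' z' :
  handle_ends R P -> handle_roots R z -> handle_ends R P' -> handle_roots R z' ->
  (P, z) <> (P', z') ->
  handle_surface P z `&` handle_surface P' z' `<=` [set P; S4C z] `&` [set P'; S4C z'].
Proof.
move=> HP z3 HP' z3' ne q [Hq Hq'].
have [qC|qC] := pselect (hatC R q).
  by rewrite -!handle_hatC //; split.
have open P0 z0 : handle_ends R P0 -> handle_surface P0 z0 q ->
    (handle_map P0 z0 @` @cylinder R) q.
  by move=> HP0 [/(hatC_ends _ z0 HP0)|].
have [x cx xq] := open P z HP Hq; have [x' cx' xq'] := open P' z' HP' Hq'.
case: ne; apply: (handle_map_inj P z P' z' x x') => //.
by rewrite xq xq'.
Qed.

Lemma sum_sqr_gt0 (b : C) : b != 0 -> 0 < complex.Re b ^+ 2 + complex.Im b ^+ 2.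
Proof.
move=> b0; rewrite lt_def addr_ge0 ?sqr_ge0 // andbT; apply: contra b0.
rewrite paddr_eq0 ?sqr_ge0 // !sqrf_eq0 /eq_op /=.
by case: (b) => x y /= /andP[/eqP-> /eqP->]; rewrite !eqxx.
Qed.

(** Off the sphere C_i u {oo} the union of the handles is the zero set of the
    discriminant. *)
Lemma handle_union a (b : C) : b != 0 ->
  (\bigcup_(P in handle_ends R) \bigcup_(z in handle_roots R) handle_surface P z)
    (S4pt a b) <->
  fibre_disc a (complex.Re b ^+ 2 + complex.Im b ^+ 2) = 0.
Proof.
move=> b0; have s0 := sum_sqr_gt0 b b0; set s := _ + _ in s0 *.
have nC : ~ hatC R (S4pt a b).
  move=> [[[c1 c2] _ /= [_ _ c3 c4]]|//].
  by move: s0; rewrite /s -c3 -c4 expr0n addr0 ltxx.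
split.
  move=> [P HP [z z3 [/(hatC_ends _ z HP)//|[x cx]]]].
  have [p0 p1 r0 sp0] := handle_map_gt0 P z x z3 cx.
  move=> -[a1 a2 b1 b2].
  have -> : a = (ray (handle_param P x.2))%:C * z.
    case: (a) (z) a1 a2 => ? ? [? ?] /= <- <-.
    by apply/eqP; rewrite eq_complex /= !mul0r subr0 addr0 !eqxx.
  apply/fibre_disc_ray => //.
  case: cx => u _; rewrite /s -b1 -b2 (scale_circle _ _ _ u).
  by rewrite sqr_sqrtr // ltW // height2_gt0.
move=> /(fibre_disc0_ray _ _ s0)[p [z [p0 p1 z3 aE sE]]].
pose P : S4 R := if p < 1 then S4C 0 else S4oo.
have HP : handle_ends R P by rewrite /P; case: ifP => _; [left|right].
exists P => //; exists z => //; right.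
pose r := Num.sqrt s.
have r0 : 0 < r by rewrite sqrtr_gt0.
have rr : r ^+ 2 = s by rewrite sqr_sqrtr // ltW.
exists (complex.Re b / r, complex.Im b / r, handle_param P p).
  split=> /=.
    by rewrite !exprMn -mulrDl -/s -rr -exprMn mulfV ?expr1n // gt_eqF.
  rewrite /P; case: ifP => /= p1'; first by rewrite p0.
  have p1'' : 1 < p by rewrite lt_def p1 leNgt p1'.
  by rewrite invr_gt0 p0 invf_lt1.
rewrite /handle_map /= handle_paramK /handle_pt /height -sE -/r /S4pt.
rewrite ![r * _]mulrC !divfK ?gt_eqF //.
by rewrite aE; case: (z) => ? ? /=; rewrite !mul0r subr0 addr0.
Qed.

(** * Counting the points of the fibres *)

Lemma S4_cases q : q = S4oo \/ exists a b, q = S4pt a b.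
Proof.
by case: q => [[[[a1 a2] b1] b2]|]; [right; exists (a1 +i* a2), (b1 +i* b2)|left].
Qed.

(** A triple root would be y = - 2 a' / 3, with a' the conjugate of a.  The
    linear coefficient then gives a'^2 = 3 a, and s = y^3 = - 8 |a|^2 / 9 <= 0,
    against s > 0. *)
Lemma no_triple_root a (s : R) : 0 < s ->
  ~ exists y, [/\ 2 * a^* = - (3 * y), a^* ^+ 2 + a = 3 * y ^+ 2 & - s%:C = - y ^+ 3].
Proof.
move=> s0 [y [pE qE /oppr_inj rE]].
have aE : a^* ^+ 2 = 3 * a.
  have : 4 * (a^* ^+ 2 - 3 * a) = 0.
    transitivity (4 * (2 * a^*) ^+ 2 - 12 * (a^* ^+ 2 + a)); first by ring.
    by rewrite pE qE; ring.
  by move=> /eqP; rewrite mulf_eq0 pnatr_eq0 subr_eq0 => /eqP.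
have sE : 9 * s%:C + 8 * `|a| ^+ 2 = 0.
  have : 3 * (9 * s%:C + 8 * `|a| ^+ 2) = 0.
    rewrite normCK rE.
    transitivity (8 * a^* * (3 * a) - (- (3 * y)) ^+ 3); first by ring.
    by rewrite -aE -pE; ring.
  by move=> /eqP; rewrite mulf_eq0 pnatr_eq0 => /eqP.
have : 0 < 9 * s%:C + 8 * `|a| ^+ 2.
  by rewrite ltr_pwDl ?mulr_gt0 ?mulr_ge0 ?exprn_ge0 ?ltr0n ?ler0n ?ltcR.
by rewrite sE ltxx.
Qed.

Lemma fibre_card a b : b != 0 ->
  fibre (S4pt a b) `&` cubic_scroll R #=
  `I_(if (fibre_disc a (complex.Re b ^+ 2 + complex.Im b ^+ 2) == 0)%R
      then 2 else 3).
Proof.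
move=> b0; apply: card_eq_trans (fibre_cubic_roots a b b0) _.
have s0 := sum_sqr_gt0 b b0.
set s := complex.Re b ^+ 2 + _ in s0 *.
have bs : b * b^* = s%:C.
  by rewrite /s; case: (b) => x y; apply/eqP; rewrite eq_complex /=;
     apply/andP; split; apply/eqP; ring.
rewrite bs; have := card_cubic_roots _ _ _ (no_triple_root a s s0).
by rewrite fibre_discE oppr_eq0; case: ifP.
Qed.

Definition exceptional : set (S4 R) :=
  [set S4C 0; S4C (-1); S4C ((1 / 2) +i* (Num.sqrt 3 / 2));
       S4C ((1 / 2) -i* (Num.sqrt 3 / 2)); S4oo].

Lemma S4CE a : S4C a = S4pt a 0.
Proof. by case: a. Qed.

(** In coordinates a = x + y i the equation reads x^2 - y^2 + x = 0 and
    y (1 - 2 x) = 0. *)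
Lemma exceptional_C a : exceptional (S4C a) <-> a^* ^+ 2 + a = 0.
Proof.
case: a => x y.
have -> : (x +i* y)^* ^+ 2 + (x +i* y) = (x ^+ 2 - y ^+ 2 + x) +i* (y - 2 * x * y).
  by apply/eqP; rewrite !exprS expr0 mulr1 eq_complex /=;
     apply/andP; split; apply/eqP; ring.
have s3 : Num.sqrt 3 ^+ 2 = 3 :> R by rewrite sqr_sqrtr.
split.
  by case=> [[[[]|]|]|//] [-> ->]; apply/eqP; rewrite eq_complex /=;
    apply/andP; split; apply/eqP; lra.
move=> [re im].
have : y * (1 - 2 * x) = 0 by rewrite -im; ring.
move=> /eqP; rewrite mulf_eq0 => /orP[/eqP y0|/eqP x2].
  have : x * (x + 1) = 0 by rewrite -re y0; ring.
  move=> /eqP; rewrite mulf_eq0 addr_eq0 => /orP[]/eqP x0.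
    by do 4!left; rewrite x0 y0.
  by do 3!left; right; rewrite x0 y0 /S4C /= oppr0.
have xE : x = 1 / 2 by lra.
have : y ^+ 2 == (Num.sqrt 3 / 2) ^+ 2.
  rewrite exprMn s3; apply/eqP; move: re; rewrite xE => re; lra.
rewrite eqf_sqr => /orP[]/eqP yE; first by do 2!left; right; rewrite xE yE.
by left; right; rewrite xE yE.
Qed.

Lemma fibre_exceptional q : exceptional q -> fibre q `<=` cubic_scroll R.
Proof.
have [->|[a [b ->]]] := S4_cases q; first by move=> _; exact: fibre_oo_sub.
move=> qe; have b0 : b = 0.
  by case: qe => [[[[]|]|]|//] [_ _]; case: b => x y /= -> ->.
by move: qe; rewrite b0 -S4CE => /exceptional_C; rewrite S4CE; exact: fibre_C_sub.
Qed.

Definition handle_sphere : set (S4 R) := hatC R `|`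
  \bigcup_(P in handle_ends R) \bigcup_(z in handle_roots R) handle_surface P z.

Lemma hatC_pt a b : hatC R (S4pt a b) -> b = 0.
Proof. by move=> [[[c1 c2] _ [_ _]]|//]; case: b => x y /= <- <-. Qed.

Lemma fibre_card_handle_sphere q : handle_sphere q -> ~ exceptional q ->
  fibre q `&` cubic_scroll R #= `I_2.
Proof.
have [->|[a [b ->]]] := S4_cases q; first by move=> _ []; right.
have [->|b0] := eqVneq b 0.
  by move=> _ ne; apply: fibre_C_card => /exceptional_C; rewrite S4CE.
case=> [/hatC_pt b00|/(handle_union _ _ b0) D0 _].
  by rewrite b00 eqxx in b0.
by have := fibre_card a b b0; rewrite D0 eqxx.
Qed.

Lemma fibre_card_off_handle_sphere q : ~ handle_sphere q -> fibre q `&` cubic_scroll R #= `I_3.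
Proof.
have [->|[a [b ->]]] := S4_cases q; first by case; left; right.
have [->|b0] := eqVneq b 0; first by case; left; left; exists a; rewrite ?S4CE.
move=> nS; have := fibre_card a b b0; case: eqP => // D0.
by case: nS; right; apply/handle_union.
Qed.

End CubicScroll.

Theorem theorem5p2 (R : realType) :
  exists (handle : S4 R -> R[i] -> set (S4 R)) (Sigma : set (S4 R)),
    [/\ (forall P z, handle_ends R P -> handle_roots R z ->
           pinched_handle P (S4C z) (handle P z)),
        (forall P z P' z', handle_ends R P -> handle_roots R z ->
           handle_ends R P' -> handle_roots R z' -> (P, z) <> (P', z') ->
           handle P z `&` handle P' z' `<=`
             [set P; S4C z] `&` [set P'; S4C z']),
        Sigma = hatC R `|`
          \bigcup_(P in handle_ends R) \bigcup_(z in handle_roots R) handle P z,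
        discriminant_locus 3 (cubic_scroll R) = Sigma &
        [/\ G0 (cubic_scroll R) =
              [set S4C 0; S4C (-1); S4C ((1 / 2) +i* (Num.sqrt 3 / 2));
                   S4C ((1 / 2) -i* (Num.sqrt 3 / 2)); S4oo],
            G0 (cubic_scroll R) `<=` hatC R,
            Gpos 1 (cubic_scroll R) = set0 &
            Gpos 2 (cubic_scroll R) = Sigma `\` G0 (cubic_scroll R)]].
Proof.
have not_card q n : exceptional R q -> ~ (fibre q `&` cubic_scroll R #= `I_n).
  move=> /fibre_exceptional/setIidPl -> qn; apply: (fibre_infinite R q).
  by apply/finite_setP; exists n.
have exc_hatC : exceptional R `<=` hatC R.
  by move=> _ [[[[]|]|]|] ->; [left; eexists..|right].
have card_inj q m n : fibre q `&` cubic_scroll R #= `I_m ->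
    fibre q `&` cubic_scroll R #= `I_n -> m = n.
  by rewrite card_eq_sym => qm qn; apply/card_eq_II; exact: card_eq_trans qm qn.
have G0E : G0 (cubic_scroll R) = exceptional R.
  apply/seteqP; split=> q; last exact: fibre_exceptional.
  rewrite /G0 /= => /setIidPl qC; apply: contrapT => ne.
  have [n qn] : exists n, fibre q `&` cubic_scroll R #= `I_n.
    have [qS|qS] := pselect (handle_sphere R q).
      by exists 2%N; exact: fibre_card_handle_sphere.
    by exists 3%N; exact: fibre_card_off_handle_sphere.
  by apply: (fibre_infinite R q); apply/finite_setP; exists n; rewrite -qC.
exists (handle_surface R), (handle_sphere R); split => //.
- by move=> P z HP z3; exact: handle_surface_pinched.
- by move=> P z P' z' HP Hz HP' Hz'; exact: handle_disjoint.
- apply/seteqP; split=> q; rewrite /discriminant_locus /=.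
    by move=> n3; apply: contrapT => /fibre_card_off_handle_sphere.
  have [qe _ /(not_card _ _ qe)//|ne qS] := pselect (exceptional R q).
  by move=> /(card_inj _ _ _ (fibre_card_handle_sphere R q qS ne)).
- rewrite G0E; split=> //.
  apply/seteqP; split=> q //; rewrite /Gpos /= => q1.
  have [/not_card/(_ q1)//|ne] := pselect (exceptional R q).
  have [qS|qS] := pselect (handle_sphere R q).
    by have := card_inj _ _ _ q1 (fibre_card_handle_sphere R q qS ne).
  by have := card_inj _ _ _ q1 (fibre_card_off_handle_sphere R q qS).
- apply/seteqP; split=> q; rewrite /Gpos /=; last by case; exact: fibre_card_handle_sphere.
  move=> q2; split; last by move=> /not_card/(_ q2).
  apply: contrapT => /fibre_card_off_handle_sphere q3.
  by have := card_inj _ _ _ q2 q3.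
Qed.
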